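(* A family $\{(\mathcal{A}_{k,\ell},\mathcal{A}_{k,r})\}_{k\in K}$ of non-unital pairs of algebras in a non-commutative probability space $(\mathcal{A},\varphi)$ is bi-Boolean independent with respect to $\varphi$ if and only if for all $n\ge2$, $\chi:\{1,\dots,n\}\to\{\ell,r\}$, $\omega:\{1,\dots,n\}\to K$, and $a_1,\dots,a_n\in\mathcal{A}$ with $a_j\in\mathcal{A}_{\omega(j),\chi(j)}$, we have $$B_\chi(a_1,\dots,a_n)=0$$ whenever $\omega$ is not constant.
   Context: A non-commutative probability space $(\mathcal{A},\varphi)$ is a unital complex algebra with a unital linear functional $\varphi$. A non-unital pair of algebras in $\mathcal{A}$ is an ordered pair $(\mathcal{A}_\ell,\mathcal{A}_r)$ of subalgebras not required to contain the unit of $\mathcal{A}$. For $\chi:\{1,\dots,n\}\to\{\ell,r\}$ with $\chi^{-1}(\{\ell\})=\{i_1<\cdots<i_p\}$ and $\chi^{-1}(\{r\})=\{i_{p+1}>\cdots>i_n\}$, let $\prec_\chi$ be the total order $i_1\prec_\chi\cdots\prec_\chi i_n$ on $\{1,\dots,n\}$. A $\chi$-interval is an interval for $\prec_\chi$. $\mathrm{BI}(\chi)$ is the set of partitions of $\{1,\dots,n\}$ all of whose blocks are $\chi$-intervals. For $V=\{v_1<\cdots<v_s\}$ put $(a_1,\dots,a_n)|_V=(a_{v_1},\dots,a_{v_s})$, and regard $\chi|_V$ as a map on $\{1,\dots,s\}$ via $v_i\leftrightarrow i$. Bi-Boolean independence: for $\omega:\{1,\dots,n\}\to K$, $\pi_{\omega,\chi}$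 is the unique maximal partition of $\{1,\dots,n\}$ whose blocks are $\chi$-intervals on each of which $\omega$ is constant. For a partition $\pi$, $\varphi_\pi(a_1,\dots,a_n)=\prod_{V=\{v_1<\cdots<v_s\}\in\pi}\varphi(a_{v_1}\cdots a_{v_s})$. The family is bi-Boolean independent with respect to $\varphi$ if $\varphi(a_1\cdots a_n)=\varphi_{\pi_{\omega,\chi}}(a_1,\dots,a_n)$ for all $n\ge1$, $\chi:\{1,\dots,n\}\to\{\ell,r\}$, $\omega:\{1,\dots,n\}\to K$, and $a_j\in\mathcal{A}_{\omega(j),\chi(j)}$. B-$(\ell,r)$-cumulants: the unique family of multilinear functionals $B_\chi:\mathcal{A}^n\to\mathbb{C}$ ($n\ge1$, $\chi:\{1,\dots,n\}\to\{\ell,r\}$) with $\varphi(a_1\cdots a_n)=\sum_{\pi\in\mathrm{BI}(\chi)}\prod_{V\in\pi}B_{\chi|_V}((a_1,\dots,a_n)|_V)$ for all $n,\chi,a_1,\dots,a_n$. *)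

(* Defs.v *)
From HB Require Import structures.
From mathcomp Require Import all_boot all_order all_algebra.
From mathcomp Require Import boolp classical_sets reals.
From mathcomp Require Import complex zify.

Set Implicit Arguments.
Unset Strict Implicit.
Unset Printing Implicit Defensive.

Import GRing.Theory.
Local Open Scope ring_scope.

Variant side := lside | rside.

Definition side_eqb (s t : side) : bool :=
  match s, t with
  | lside, lside | rside, rside => true
  | _, _ => false
  end.

Lemma side_eqbP : Equality.axiom side_eqb.
Proof. by case; case; constructor. Qed.

HB.instance Definition _ := hasDecEq.Build side side_eqbP.

(* Points are 0, ..., n-1 rather than 1, ..., n. *)
Section ChiOrder.
Variables (n : nat) (chi : {ffun 'I_n -> side}).

Definition chi_seq : seq 'I_n :=
  [seq i <- enum 'I_n | chi i == lside] ++
  rev [seq i <- enum 'I_n | chi i == rside].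

Definition chi_lt (i j : 'I_n) : bool :=
  (index i chi_seq < index j chi_seq)%N.

Definition chi_interval (V : {set 'I_n}) : bool :=
  [forall i in V, forall k in V, forall j,
     (chi_lt i j && chi_lt j k) ==> (j \in V)].

Definition BI : {set {set {set 'I_n}}} :=
  [set P | finset.partition P [set: 'I_n] & [forall V in P, chi_interval V]].

Variables (K : Type) (omega : 'I_n -> K).

Definition BI_const (P : {set {set 'I_n}}) : Prop :=
  P \in BI /\
  forall V, V \in P -> forall i j, i \in V -> j \in V -> omega i = omega j.

Definition refines (P Q : {set {set 'I_n}}) : bool :=
  [forall V in P, exists W in Q, V \subset W].

Definition maximal_BI_const (P : {set {set 'I_n}}) : Prop :=
  BI_const P /\ forall Q, BI_const Q -> refines P Q -> Q = P.

(* The default value [finset.set0] is never used, and the choice made by [xget]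
   is irrelevant: see [pi_omegaP] and [pi_omega_uniq]. *)
Definition pi_omega : {set {set 'I_n}} :=
  xget finset.set0 (fun P : {set {set 'I_n}} => maximal_BI_const P).

End ChiOrder.

(* [enum_val] lists the elements of V in increasing order. *)
Definition restr (T : Type) (n : nat) (f : {ffun 'I_n -> T}) (V : {set 'I_n}) :
    {ffun 'I_#|V| -> T} :=
  [ffun i => f (enum_val i)].

Definition update (T : Type) (n : nat) (a : {ffun 'I_n -> T}) (i : 'I_n) (u : T) :
    {ffun 'I_n -> T} :=
  [ffun j => if j == i then u else a j].

Section Probability.
Variables (R : realType) (A : algType R[i]) (phi : {scalar A}).

Definition nonunital_subalgebra (S : set A) : Prop :=
  [/\ S 0,
      forall (c : R[i]) (u v : A), S u -> S v -> S (c *: u + v) &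
      forall u v : A, S u -> S v -> S (u * v)].

Definition moment (n : nat) (a : {ffun 'I_n -> A}) : R[i] :=
  phi (\prod_(i < n) a i).

Definition moment_part (n : nat) (P : {set {set 'I_n}}) (a : {ffun 'I_n -> A}) :
    R[i] :=
  \prod_(V in P) moment (restr a V).

Definition bi_Boolean_independent (K : Type) (F : K -> side -> set A) : Prop :=
  forall n : nat, (1 <= n)%N ->
  forall (chi : {ffun 'I_n -> side}) (omega : 'I_n -> K) (a : {ffun 'I_n -> A}),
    (forall j, F (omega j) (chi j) (a j)) ->
    moment a = moment_part (pi_omega chi omega) a.

Definition multilinear (n : nat) (f : {ffun 'I_n -> A} -> R[i]) : Prop :=
  forall (i : 'I_n) (a : {ffun 'I_n -> A}) (c : R[i]) (u v : A),
    f (update a i (c *: u + v)) = c * f (update a i u) + f (update a i v).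

Definition functionals : Type :=
  forall n : nat, {ffun 'I_n -> side} -> {ffun 'I_n -> A} -> R[i].

(* Only the values for n >= 1 are constrained; there, such a family exists and
   is unique ([B_cumulants_exist], [B_cumulants_uniq]). *)
Definition B_cumulants (B : functionals) : Prop :=
  forall n : nat, (1 <= n)%N -> forall chi : {ffun 'I_n -> side},
    multilinear (B n chi) /\
    forall a : {ffun 'I_n -> A},
      moment a =
      \sum_(P in BI chi) \prod_(V in P) B #|V| (restr chi V) (restr a V).

End Probability.

Section PiOmegaTheory.
Variables (n : nat) (chi : {ffun 'I_n -> side}).
Variables (K : Type) (omega : 'I_n -> K).

Local Notation rk i := (index i (chi_seq chi)).

Lemma mem_chi_seq i : i \in chi_seq chi.
Proof.
rewrite mem_cat mem_rev !(mem_filter _ _ (enum 'I_n)) mem_enum !andbT.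
by case: (chi i).
Qed.

Lemma chi_rank_inj i j : rk i = rk j -> i = j.
Proof.
move=> e; rewrite -(nth_index i (mem_chi_seq i)) e.
exact: (nth_index i (mem_chi_seq j)).
Qed.

Let btw (x y z : nat) : bool := (x <= z <= y)%N || (y <= z <= x)%N.

Let btw_l x y : btw x y x.
Proof. by rewrite /btw leqnn /= andbT; exact: leq_total. Qed.

Let btwC x y z : btw x y z = btw y x z.
Proof. by rewrite /btw orbC. Qed.

Let btw_r x y : btw x y y.
Proof. by rewrite btwC btw_l. Qed.

Let btw_trans x y z w : btw x z w -> btw x y w || btw y z w.
Proof.
rewrite /btw => /orP[] /andP[-> ->]; rewrite ?andbT /=.
  by case: (leqP w y) => [//|/ltnW->]; rewrite ?orbT.
by case: (leqP w y) => [_|/ltnW->]; rewrite ?orbT.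
Qed.

Let btw_sub x y z w : (x < y)%N -> (y < z)%N -> btw x y w -> btw x z w.
Proof.
rewrite /btw => xy yz /orP[/andP[-> wy]|/andP[yw wx]] /=.
  by rewrite (leq_trans wy (ltnW yz)).
by have := leq_ltn_trans (leq_trans yw wx) xy; rewrite ltnn.
Qed.

Let linked (i j : 'I_n) : bool :=
  `[< forall k, btw (rk i) (rk j) (rk k) -> omega k = omega i >].

Let linked_equiv : {in [set: 'I_n] & &, equivalence_rel linked}.
Proof.
have eE i j : linked i j -> omega j = omega i.
  by move=> /asboolP; apply; exact: btw_r.
have tr i j k : linked i j -> linked j k -> linked i k.
  move=> lij ljk; apply/asboolP => l /(@btw_trans _ (rk j))/orP[] b.
    by move/asboolP: lij; apply.
  by rewrite -(eE _ _ lij); move/asboolP: ljk; apply.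
have sy i j : linked i j -> linked j i.
  move=> lij; apply/asboolP => k; rewrite btwC (eE _ _ lij) => bk.
  by move/asboolP: lij; apply.
move=> i j k _ _ _; split.
  apply/asboolP => l; rewrite /btw orbb -eqn_leq => /eqP e.
  by congr omega; apply/esym/chi_rank_inj.
by move=> lij; apply/idP/idP; apply: tr => //; exact: sy.
Qed.

Let G := equivalence_partition linked [set: 'I_n].

Let G_part : finset.partition G [set: 'I_n].
Proof. exact: equivalence_partitionP linked_equiv. Qed.

Let G_pblock i j : (j \in finset.pblock G i) = linked i j.
Proof. by rewrite (pblock_equivalence_partition linked_equiv) ?inE. Qed.

Let G_linked V i j : V \in G -> i \in V -> (j \in V) = linked i j.
Proof.
move=> VG iV; rewrite -G_pblock; congr (_ \in _).
by rewrite (def_pblock _ VG iV) //; case/and3P: G_part.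
Qed.

Let G_BI_const : BI_const chi omega G.
Proof.
split; last first.
  move=> V VG i j iV; rewrite (G_linked j VG iV) => /asboolP l.
  exact/esym/l/btw_r.
rewrite inE G_part /=; apply/forall_inP => V VG.
apply/forall_inP => i iV; apply/forall_inP => k; rewrite (G_linked _ VG iV).
move=> /asboolP lik; apply/forallP => j; apply/implyP => /andP[ij jk].
rewrite (G_linked j VG iV); apply/asboolP => l bl; apply: lik.
exact: btw_sub bl.
Qed.

Let G_top Q : BI_const chi omega Q -> refines Q G.
Proof.
case; rewrite inE => /andP[Qp /forall_inP Qi] Qc.
apply/forall_inP => V VQ.
have /set0Pn[i iV] : V != finset.set0.
  by apply: contraTneq VQ => ->; case/and3P: Qp.
apply/exists_inP; exists (finset.pblock G i).
  by rewrite pblock_mem // (cover_partition G_part) inE.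
apply/fintype.subsetP => j jV; rewrite G_pblock; apply/asboolP => k bk.
apply: (Qc V) => //.
have /forall_inP Vi := Qi V VQ.
have conv p q : p \in V -> q \in V -> (rk p <= rk k <= rk q)%N -> k \in V.
  move=> pV qV /andP[].
  rewrite leq_eqVlt => /orP[/eqP/chi_rank_inj<-//|pk].
  rewrite leq_eqVlt => /orP[/eqP/chi_rank_inj->//|kq].
  have /forall_inP/(_ q qV)/forallP/(_ k) := Vi p pV.
  by rewrite /chi_lt pk kq.
by move: bk => /orP[]; exact: conv.
Qed.

Let refines_anti P Q : finset.partition P [set: 'I_n] ->
  finset.partition Q [set: 'I_n] -> refines P Q -> refines Q P -> Q = P.
Proof.
move=> Pp Qp PQ QP.
have sub P1 Q1 : finset.partition P1 [set: 'I_n] -> refines P1 Q1 ->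
    refines Q1 P1 -> P1 \subset Q1.
  move=> P1p /forall_inP P1Q1 /forall_inP Q1P1; apply/fintype.subsetP => V VP.
  have /exists_inP[W WQ VW] := P1Q1 V VP.
  have /exists_inP[U UP WU] := Q1P1 W WQ.
  case/and3P: P1p => _ /finset.trivIsetP tP P0.
  suff UV : U = V by rewrite (_ : V = W)//; apply/eqP; rewrite finset.eqEsubset VW -UV WU.
  apply/eqP; apply: contraNT P0 => nUV.
  have /(disjointWl (fintype.subset_trans VW WU)) := tP U V UP VP nUV.
  by rewrite -setI_eq0 finset.setIid => /eqP<-.
by apply/eqP; rewrite finset.eqEsubset !sub.
Qed.

Lemma pi_omega_uniq P Q :
  maximal_BI_const chi omega P -> maximal_BI_const chi omega Q -> P = Q.
Proof.
by move=> [Pc Pm] [Qc Qm]; rewrite -(Pm G) ?G_top// -(Qm G) ?G_top.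
Qed.

Lemma pi_omegaP : maximal_BI_const chi omega (pi_omega chi omega).
Proof.
apply: xgetPex; exists G; split=> // Q Qc GQ.
apply: refines_anti => //; last exact: G_top.
by case: Qc; rewrite inE => /andP[].
Qed.

End PiOmegaTheory.

Section CumulantTheory.
Variables (R : realType) (A : algType R[i]) (phi : {scalar A}).
Local Notation functionals := (functionals A).

Let Btop n : {set {set 'I_n}} := [set [set: 'I_n]].

Let Btop_BI n (chi : {ffun 'I_n -> side}) : (0 < n)%N -> Btop n \in BI chi.
Proof.
move=> n0; rewrite inE; apply/andP; split.
  apply/and3P; split; first by rewrite cover1.
    exact: finset.trivIset1.
  rewrite inE eq_sym -cards_eq0 cardsT card_ord; lia.
apply/forall_inP => V /set1P ->.
by do 2!apply/forall_inP => ? _; apply/forallP => ?; rewrite inE implybT.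
Qed.

Let block_lt n (chi : {ffun 'I_n -> side}) P V :
  P \in BI chi -> P != Btop n -> V \in P -> (0 < #|V| < n)%N.
Proof.
rewrite inE => /andP[/and3P[_ /finset.trivIsetP tP P0] _] nP VP; apply/andP; split.
  by rewrite card_gt0; apply: contraNneq P0 => <-.
rewrite -[X in (_ < X)%N]card_ord -cardsT; apply: proper_card.
rewrite finset.properT; apply: contraNneq nP => VT.
rewrite finset.eqEsubset finset.sub1set -VT VP andbT; apply/fintype.subsetP => W WP.
rewrite inE -VT; apply: contraNT P0 => nWV.
have := tP W V WP VP nWV; rewrite -setI_eq0 VT finset.setIT => /eqP<- //.
Qed.

Let restr_setT n (B : functionals) (chi : {ffun 'I_n -> side})
    (a : {ffun 'I_n -> A}) :
  B #|[set: 'I_n]| (restr chi [set: 'I_n]) (restr a [set: 'I_n]) = B n chi a.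
Proof.
have gen m (e : m = n) (chi' : {ffun 'I_m -> side}) (a' : {ffun 'I_m -> A}) :
    (forall i, chi' i = chi (cast_ord e i)) ->
    (forall i, a' i = a (cast_ord e i)) -> B m chi' a' = B n chi a.
  subst n => c1 c2; congr (B _ _ _); apply/ffunP => i.
    by rewrite c1 cast_ord_id.
  by rewrite c2 cast_ord_id.
have e : #|[set: 'I_n]| = n by rewrite cardsT card_ord.
have ev i : enum_val i = cast_ord e i.
  apply: val_inj; rewrite /= (enum_val_nth (cast_ord e i)) enum_setT -enumT.
  by rewrite nth_enum_ord // -[X in (_ < X)%N]e.
by apply: (gen _ e) => i; rewrite ffunE ev.
Qed.

Let moment_cumulant (B : functionals) n (chi : {ffun 'I_n -> side}) a :
  (0 < n)%N ->
  \sum_(P in BI chi) \prod_(V in P) B #|V| (restr chi V) (restr a V) =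
  B n chi a + \sum_(P in BI chi | P != Btop n)
                \prod_(V in P) B #|V| (restr chi V) (restr a V).
Proof.
move=> n0; rewrite (bigD1 (Btop n)) ?Btop_BI //=; congr (_ + _).
by rewrite big_set1 restr_setT.
Qed.

Lemma B_cumulants_uniq (B B' : functionals) :
  B_cumulants phi B -> B_cumulants phi B' ->
  forall n, (1 <= n)%N -> forall (chi : {ffun 'I_n -> side}) a,
    B n chi a = B' n chi a.
Proof.
move=> hB hB' n; have [N] := ubnP n; elim: N n => // N IH n nN n0 chi a.
have [_ /(_ a)] := hB n n0 chi; have [_ /(_ a) ->] := hB' n n0 chi.
rewrite !moment_cumulant // => /esym e; apply: (addIr _ (etrans e _)).
congr (_ + _); apply: eq_bigr => P /andP[PB Pt]; apply: eq_bigr => V VP.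
by have /andP[V0 Vn] := block_lt PB Pt VP; rewrite IH //; lia.
Qed.

Fixpoint B_rec (N : nat) : functionals := fun n chi a =>
  if N is N'.+1 then
    moment phi a - \sum_(P in BI chi | P != Btop n)
                      \prod_(V in P) B_rec N' (restr chi V) (restr a V)
  else 0.

Let B_rec_stable N M n (chi : {ffun 'I_n -> side}) a :
  (0 < n <= N)%N -> (n <= M)%N -> B_rec N chi a = B_rec M chi a.
Proof.
elim: N M n chi a => [|N IH] [|M] n chi a //=; try lia.
move=> /andP[_ nN] nM; congr (_ - _); apply: eq_bigr => P /andP[PB Pt].
apply: eq_bigr => V VP; have /andP[V0 Vn] := block_lt PB Pt VP.
apply: IH; last by rewrite -ltnS (leq_trans Vn).
by rewrite V0 -ltnS (leq_trans Vn).
Qed.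

Let B_def : functionals := fun n => @B_rec n n.

Let B_formula n (chi : {ffun 'I_n -> side}) a : (0 < n)%N ->
  B_def chi a = moment phi a - \sum_(P in BI chi | P != Btop n)
    \prod_(V in P) B_def (restr chi V) (restr a V).
Proof.
case: n chi a => // n chi a _; rewrite {1}/B_def /=; congr (_ - _).
apply: eq_bigr => P /andP[PB Pt]; apply: eq_bigr => V VP.
have /andP[V0 Vn] := block_lt PB Pt VP.
by apply: B_rec_stable => //; rewrite V0 -ltnS.
Qed.

Let moment_multilinear n : multilinear (@moment R A phi n).
Proof.
move=> i a c u v; rewrite /moment -linearP /=; congr (phi _).
have := mem_index_enum i; have := index_enum_uniq 'I_n.
elim: (index_enum _) => // j r IH /= /andP[jr ur]; rewrite inE !big_cons.
have [->{IH} _|ij /= ir] := eqVneq i j; last first.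
  by rewrite IH // !ffunE eq_sym (negPf ij) mulrDr scalerAr.
have same w : \prod_(k <- r) update a j w k = \prod_(k <- r) a k.
  by apply: eq_big_seq => k kr; rewrite ffunE; case: eqP kr jr => // -> ->.
by rewrite !same !ffunE eqxx mulrDl scalerAl.
Qed.

Lemma restr_update_notin (T : Type) n (a : {ffun 'I_n -> T}) i u
    (V : {set 'I_n}) :
  i \notin V -> restr (update a i u) V = restr a V.
Proof.
move=> iV; apply/ffunP => j; rewrite !ffunE; case: eqP => // e.
by move: iV; rewrite -e enum_valP.
Qed.

Lemma restr_update_in (T : Type) n (a : {ffun 'I_n -> T}) i u
    (V : {set 'I_n}) (iV : i \in V) :
  restr (update a i u) V = update (restr a V) (enum_rank_in iV i) u.
Proof.
apply/ffunP => j; rewrite !ffunE.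
by rewrite -{1}(enum_rankK_in iV iV) (inj_eq enum_val_inj).
Qed.

Let B_multilinear n (chi : {ffun 'I_n -> side}) :
  (0 < n)%N -> multilinear (@B_def n chi).
Proof.
have [N] := ubnP n; elim: N n chi => // N IH n chi nN n0 i a c u v.
rewrite !B_formula // moment_multilinear mulrBr mulr_sumr addrACA -opprD.
congr (_ - _); rewrite -big_split /=.
apply: eq_bigr => P /andP[PB Pt].
have Pp : finset.partition P [set: 'I_n] by move: PB; rewrite inE => /andP[].
have iP : i \in finset.cover P by rewrite (cover_partition Pp) inE.
set W := finset.pblock P i.
have WP : W \in P by exact: pblock_mem.
have iW : i \in W by rewrite mem_pblock.
rewrite !(bigD1 (P := fun V => V \in P) W) //=.
have rest w : \prod_(V in P | V != W)
      B_def (restr chi V) (restr (update a i w) V) =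
    \prod_(V in P | V != W) B_def (restr chi V) (restr a V).
  apply: eq_bigr => V /andP[VP VW]; rewrite restr_update_notin //.
  apply: contraNN VW => iV; apply/eqP/esym/def_pblock => //.
  by case/and3P: Pp.
have /andP[W0 Wn] := block_lt PB Pt WP.
rewrite !rest !(restr_update_in _ _ iW) IH ?(leq_trans Wn) //.
by rewrite mulrDl mulrA.
Qed.

Lemma B_cumulants_exist : exists B : functionals, B_cumulants phi B.
Proof.
exists B_def => n n0 chi; split; first exact: B_multilinear.
by move=> a; rewrite moment_cumulant // B_formula // subrK.
Qed.

End CumulantTheory.

(* Main.v *)
(** Expanding each factor of the product of moments over the blocks of a
    bi-interval partition P by the moment-cumulant formula gives the sum of the
    cumulant products over the bi-interval partitions Q finer than P.  Take
    P = pi_omega, which is coarser than every bi-interval partition with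
    omega-constant blocks: bi-Boolean independence says that the cumulant
    products over the Q having a block on which omega is not constant sum to 0.
    This is clear if mixed cumulants vanish; conversely, by induction on n every
    term but that of the one-block partition vanishes, hence so does B_chi. *)

Require Import Defs.
From mathcomp Require Import all_boot all_order all_algebra.
From mathcomp Require Import boolp classical_sets reals.
From mathcomp Require Import complex.

Set Implicit Arguments.
Unset Strict Implicit.
Unset Printing Implicit Defensive.

Import GRing.Theory.
Local Open Scope ring_scope.

(** * Set partitions and the partitions finer than a given one *)

Lemma trivIset_mem_eq (T : finType) (P : {set {set T}}) (V W : {set T})
    (x : T) :
  finset.trivIset P -> V \in P -> W \in P -> x \in V -> x \in W -> V = W.
Proof.
move=> tP VP WP xV xW.
by rewrite -(def_pblock tP VP xV) (def_pblock tP WP xW).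
Qed.

Lemma partition_block_mem (T : finType) (P : {set {set T}}) (D W : {set T}) :
  finset.partition P D -> W \in P -> exists x, x \in W.
Proof. by move=> Pp WP; apply/set0Pn; exact: partition_neq0 Pp WP. Qed.

Lemma partition_covers (T : finType) (P : {set {set T}}) (D : {set T}) (x : T) :
  finset.partition P D -> x \in D -> exists2 V, V \in P & x \in V.
Proof.
move=> Pp; rewrite -(cover_partition Pp) => xP.
by exists (finset.pblock P x); rewrite ?pblock_mem ?mem_pblock.
Qed.

(** By distributivity the left side is a sum over all choices of a partition of every block of [P].
    Such choices correspond to the partitions of [D] finer than [P]: take the union in one
    direction, and the blocks of [Q] inside each [V] in the other. *)
Lemma prod_sum_partition (S : comPzSemiRingType) (T : finType) (D : {set T})
    (P : {set {set T}}) (w : {set T} -> S) : finset.partition P D ->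
  \prod_(V in P) \sum_(Q : {set {set T}} | finset.partition Q V)
     \prod_(W in Q) w W =
  \sum_(Q : {set {set T}} | finset.partition Q D &&
                            [forall W in Q, exists V in P, W \subset V])
     \prod_(W in Q) w W.
Proof.
move=> Pp; have tP := partition_trivIset Pp.
rewrite (big_distr_big_dep finset.set0) /=.
(* [h] cuts [Q] along [P] and [h'] glues the pieces back; [finset.set0] is the default value that
   [pfamily] demands outside [P]. *)
pose h (Q : {set {set T}}) : {ffun {set T} -> {set {set T}}} :=
  [ffun V => if V \in P then [set W in Q | W \subset V] else finset.set0].
pose h' (f : {ffun {set T} -> {set {set T}}}) := \bigcup_(V in P) f V.
rewrite (reindex_onto h h') => [|f /pfamilyP[/supportP f0 fP]]; last first.
  apply/ffunP => V; rewrite ffunE; case: ifPn => [VP|/f0 //].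
  have fVp : finset.partition (f V) V by have := fP V VP; rewrite unfold_in.
  apply/setP => W; rewrite inE; apply/andP/idP => [[/bigcupP[U UP WU] WV]|WfV].
    have fUp : finset.partition (f U) U by have := fP U UP; rewrite unfold_in.
    have [x xW] := partition_block_mem fUp WU.
    have xU := fintype.subsetP (partitionS fUp WU) _ xW.
    by rewrite -(trivIset_mem_eq tP UP VP xU (fintype.subsetP WV _ xW)).
  by split; [apply/bigcupP; exists V | exact: partitionS WfV].
have hV Q V : V \in P -> h Q V = [set W in Q | W \subset V].
  by move=> VP; rewrite ffunE VP.
have cond Q : (h Q \in pfamily finset.set0 (fun V => V \in P)
        (fun V (Q0 : {set {set T}}) => finset.partition Q0 V)) &&
      (h' (h Q) == Q) =
    finset.partition Q D && [forall W in Q, exists V in P, W \subset V].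
  apply/andP/andP => [[/pfamilyP[_ fP] /eqP hQ]|[Qp /forall_inP QP]].
    have {}fP V : V \in P -> finset.partition [set W in Q | W \subset V] V.
      by move=> VP; have := fP V VP; rewrite unfold_in hV.
    have QP W : W \in Q -> exists2 V, V \in P & W \subset V.
      rewrite -{1}hQ => /bigcupP[V VP]; rewrite hV // inE => /andP[_ WV].
      by exists V.
    have Qx W : W \in Q -> exists x, x \in W.
      move=> WQ; have [V VP WV] := QP W WQ.
      by apply: partition_block_mem (fP V VP) _; rewrite inE WQ.
    split; last first.
      by apply/forall_inP => W /QP[V VP WV]; apply/exists_inP; exists V.
    apply/and3P; split.
    - apply/eqP/setP => x; apply/bigcupP/idP => [[W WQ xW]|].
        have [V VP /fintype.subsetP/(_ x xW) xV] := QP W WQ.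
        exact: fintype.subsetP (partitionS Pp VP) _ xV.
      move=> /(partition_covers Pp)[V VP /(partition_covers (fP V VP))[W]].
      by rewrite inE => /andP[WQ _] xW; exists W.
    - apply/finset.trivIsetP => W1 W2 W1Q W2Q; apply: contraR.
      move=> /pred0Pn[x /andP[/= x1 x2]]; apply/eqP.
      have [V1 V1P s1] := QP _ W1Q; have [V2 V2P s2] := QP _ W2Q.
      have eV := trivIset_mem_eq tP V1P V2P (fintype.subsetP s1 _ x1)
        (fintype.subsetP s2 _ x2).
      apply: (trivIset_mem_eq (partition_trivIset (fP V1 V1P)) _ _ x1 x2).
        by rewrite inE W1Q.
      by rewrite inE W2Q eV.
    - by apply/negP => /Qx[x]; rewrite inE.
  split; last first.
    apply/eqP/setP => W; apply/bigcupP/idP => [[V VP]|WQ].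
      by rewrite hV // inE => /andP[].
    by have /exists_inP[V VP WV] := QP W WQ; exists V; rewrite ?hV ?inE ?WQ.
  apply/pfamilyP; split.
    by apply/supportP => V VP; rewrite ffunE (negPf VP).
  move=> V VP; rewrite unfold_in hV //; apply/and3P; split.
  - apply/eqP/setP => x; apply/bigcupP/idP => [[W]|xV].
      by rewrite inE => /andP[_ /fintype.subsetP]; exact.
    have xD := fintype.subsetP (partitionS Pp VP) _ xV.
    have [W WQ xW] := partition_covers Qp xD.
    have /exists_inP[U UP WU] := QP W WQ.
    rewrite (trivIset_mem_eq tP VP UP xV (fintype.subsetP WU _ xW)).
    by exists W; rewrite ?inE ?WQ.
  - apply: finset.trivIsetS (partition_trivIset Qp).
    by apply/fintype.subsetP => W; rewrite inE => /andP[].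
  - by rewrite inE (partition0 Qp).
apply: eq_big => [Q|Q]; first exact: cond.
rewrite cond => /andP[Qp /forall_inP QP].
transitivity (\prod_(V in P) \prod_(W in Q | W \subset V) w W).
  by apply: eq_bigr => V VP; rewrite hV //; apply: eq_bigl => W; rewrite inE.
(* A block of [Q] is nonempty and the blocks of [P] are disjoint, so it lies in exactly one [V] and
   each factor occurs once. *)
rewrite (exchange_big_dep (mem Q)) /=; last by move=> V W _ /andP[].
apply: eq_bigr => W WQ; have /exists_inP[U UP WU] := QP W WQ.
rewrite (big_pred1 U) // => V; rewrite WQ /=; apply/andP/eqP => [[VP WV]|->//].
have [x xW] := partition_block_mem Qp WQ.
have xV := fintype.subsetP WV _ xW.
exact: (trivIset_mem_eq tP VP UP xV (fintype.subsetP WU _ xW)).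
Qed.

(** * The partition [pi_omega] as the coarsest one *)

(** In a finite order every element lies below a maximal one, and [pi_omega] is the only maximal
    one. *)
Lemma refines_pi_omega (n : nat) (chi : {ffun 'I_n -> side}) (K : Type)
    (omega : 'I_n -> K) (Q : {set {set 'I_n}}) :
  BI_const chi omega Q -> refines Q (pi_omega chi omega).
Proof.
move=> Qc.
(* [E P] is the same-block relation of [P]. Coarsening enlarges it strictly, so a [P] above [Q] with
   the largest [E P] is maximal. *)
pose E (P : {set {set 'I_n}}) : {set 'I_n * 'I_n} :=
  [set p | p.2 \in finset.pblock P p.1].
pose ok P := `[< BI_const chi omega P >] && refines Q P.
have okQ : ok Q.
  rewrite /ok asboolT //=; apply/forall_inP => V VQ.
  by apply/exists_inP; exists V.
case: (arg_maxnP (fun P => #|E P|) okQ) => P /andP[/asboolP Pc QP] Pmax.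
suff Pm : maximal_BI_const chi omega P.
  by rewrite (pi_omega_uniq (pi_omegaP chi omega) Pm).
have part P' : BI_const chi omega P' -> finset.partition P' [set: 'I_n].
  by case; rewrite inE => /andP[].
split=> // P' P'c PP'.
have EE : E P \subset E P'.
  apply/fintype.subsetP => -[x y]; rewrite !inE /= => xy.
  have xP : x \in finset.cover P by rewrite (cover_partition (part _ Pc)) inE.
  have /exists_inP[W WP' VW] := forall_inP PP' _ (pblock_mem xP).
  rewrite (def_pblock (partition_trivIset (part _ P'c)) WP' (x := x)).
    exact: fintype.subsetP VW _ xy.
  by apply: fintype.subsetP VW _ _; rewrite mem_pblock.
have okP' : ok P'.
  rewrite /ok asboolT //=; apply/forall_inP => V VQ.
  have /exists_inP[U UP VU] := forall_inP QP V VQ.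
  have /exists_inP[W WP UW] := forall_inP PP' U UP.
  by apply/exists_inP; exists W => //; exact: fintype.subset_trans UW.
have /eqP eE : E P == E P' by rewrite eqEcard EE; exact: Pmax.
(* A partition is recovered from its same-block relation. *)
rewrite -(preim_partition_pblock (part _ Pc)).
rewrite -(preim_partition_pblock (part _ P'c)).
congr preim_partition; apply/funext => x; apply/setP => y.
by have /setP/(_ (x, y)) := eE; rewrite !inE.
Qed.

(** * The chi-order and chi-intervals under restriction *)

(* The order of [chi_seq] spelled out on values, so that its compatibility with
   the increasing map [enum_val] can be checked. *)
Definition chi_rel (n : nat) (chi : {ffun 'I_n -> side}) : rel 'I_n :=
  fun i j => match chi i, chi j with
  | lside, rside => true
  | rside, lside => false
  | lside, lside => (i < j)%N
  | rside, rside => (j < i)%N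
  end.

Lemma sorted_enum_ord (n : nat) (V : {pred 'I_n}) :
  sorted (relpre val ltn) (enum V).
Proof.
have -> : enum V = filter V (enum 'I_n) by rewrite {2}/enum_mem filter_predT.
apply: sorted_filter; first by move=> j i k; exact: ltn_trans.
by rewrite -sorted_map val_enum_ord iota_ltn_sorted.
Qed.

(** [chi_seq] is sorted for [chi_rel], so a smaller index implies [chi_rel]. Conversely, distinct
    points have distinct indices and [chi_rel] is asymmetric. *)
Lemma chi_ltE (n : nat) (chi : {ffun 'I_n -> side}) : chi_lt chi =2 chi_rel chi.
Proof.
have tr : transitive (chi_rel chi).
  move=> j i k; rewrite /chi_rel.
  case: (chi i); case: (chi j); case: (chi k) => //; first exact: ltn_trans.
  by move=> ji kj; exact: ltn_trans ji.
have trv : transitive (relpre (val : 'I_n -> nat) ltn).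
  by move=> j i k; exact: ltn_trans.
have so : sorted (chi_rel chi) (chi_seq chi).
  rewrite (sorted_pairwise tr) pairwise_cat; apply/and3P; split.
  - apply/allrelP => i j; rewrite mem_rev !mem_filter.
    by rewrite /chi_rel => /andP[/eqP -> _] /andP[/eqP ->].
  - have := sorted_enum_ord 'I_n; rewrite (sorted_pairwise trv).
    move=> /(pairwise_filter (fun i => chi i == lside)).
    apply: (sub_in_pairwise (P := fun i => chi i == lside)) (filter_all _ _).
    by move=> i j; rewrite !unfold_in /chi_rel => /eqP-> /eqP->.
  - rewrite -(sorted_pairwise tr) rev_sorted sorted_pairwise; last first.
      by move=> j i k; exact: (fun p q => tr _ _ _ q p).
    have := sorted_enum_ord 'I_n; rewrite (sorted_pairwise trv).
    move=> /(pairwise_filter (fun i => chi i == rside)).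
    apply: (sub_in_pairwise (P := fun i => chi i == rside)) (filter_all _ _).
    by move=> i j; rewrite !unfold_in /chi_rel => /eqP-> /eqP->.
have lt_rel i j : chi_lt chi i j -> chi_rel chi i j.
  by apply: (sorted_ltn_index tr so); exact: mem_chi_seq.
move=> i j; apply/idP/idP => [|rij]; first exact: lt_rel.
rewrite /chi_lt ltnNge leq_eqVlt negb_or; apply/andP; split.
  apply/negP => /eqP/chi_rank_inj eij; move: rij.
  by rewrite eij /chi_rel; case: (chi i); rewrite ltnn.
apply/negP => /lt_rel; move: rij; rewrite /chi_rel.
by case: (chi i); case: (chi j) => //; case: ltngtP.
Qed.

Lemma enum_val_ltn (n : nat) (V : {set 'I_n}) (i j : 'I_#|V|) :
  (enum_val i < enum_val j)%N = (i < j)%N.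
Proof.
have homo (k l : 'I_#|V|) : (k < l)%N -> (enum_val k < enum_val l)%N.
  move=> kl; have x0 := enum_val k; rewrite !(enum_val_nth x0).
  have trv : transitive (relpre (val : 'I_n -> nat) ltn).
    by move=> p q r; exact: ltn_trans.
  have := sorted_ltn_nth trv x0 (sorted_enum_ord (mem V)).
  by move/(_ (val k) (val l)); rewrite !inE -!cardE !ltn_ord; exact.
apply/idP/idP => [|/homo //]; case: (ltngtP i j) => // [/homo|/val_inj->].
  by move=> ji ij; have := ltn_trans ij ji; rewrite ltnn.
by rewrite ltnn.
Qed.

(** [chi_rel] sees only the sides and the natural order of two points, and [enum_val] preserves
    both. *)
Lemma chi_lt_restr (n : nat) (chi : {ffun 'I_n -> side}) (V : {set 'I_n})
    (i j : 'I_#|V|) :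
  chi_lt (restr chi V) i j = chi_lt chi (enum_val i) (enum_val j).
Proof. by rewrite !chi_ltE /chi_rel !ffunE !enum_val_ltn. Qed.

(** Since [V] is a chi-interval, any point between two points of the image of [W] lies in [V], hence
    comes from ['I_#|V|]. *)
Lemma chi_interval_restr (n : nat) (chi : {ffun 'I_n -> side}) (V : {set 'I_n})
    (W : {set 'I_#|V|}) : chi_interval chi V ->
  chi_interval (restr chi V) W = chi_interval chi (enum_val @: W).
Proof.
move=> Vi; apply/forall_inP/forall_inP => [Wi _ /imsetP[i iW ->]|Wi i iW].
  apply/forall_inP => _ /imsetP[k kW ->]; apply/forallP => j.
  apply/implyP => ijk; have jV : j \in V.
    move/forall_inP/(_ _ (enum_valP i)): Vi => /forall_inP/(_ _ (enum_valP k)).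
    by move=> /forallP/(_ j)/implyP; exact.
  rewrite -(enum_rankK_in jV jV) in ijk *; apply: imset_f.
  move/forall_inP/(_ k kW)/forallP/(_ (enum_rank_in jV j))/implyP: (Wi i iW).
  by apply; rewrite !chi_lt_restr.
apply/forall_inP => k kW; apply/forallP => j; rewrite !chi_lt_restr.
apply/implyP => ijk; rewrite -(mem_imset _ _ enum_val_inj).
move/forall_inP: (Wi _ (imset_f enum_val iW)) => /(_ _ (imset_f enum_val kW)).
by move=> /forallP/(_ (enum_val j))/implyP; exact.
Qed.

(** Both lists are strictly increasing with the same members. This makes two successive restrictions
    agree with a single one. *)
Lemma enum_imset_enum_val (n : nat) (V : {set 'I_n}) (W : {set 'I_#|V|}) :
  enum (enum_val @: W : {set 'I_n}) = map enum_val (enum W).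
Proof.
have trv : transitive (relpre (val : 'I_n -> nat) ltn).
  by move=> p q r; exact: ltn_trans.
apply: (irr_sorted_eq trv); first by move=> i /=; exact: ltnn.
- exact: sorted_enum_ord.
- rewrite sorted_map (eq_sorted (e' := relpre val ltn)) ?sorted_enum_ord //.
  by move=> i j /=; rewrite enum_val_ltn.
move=> i; rewrite mem_enum; apply/imsetP/mapP => -[j jW ->]; exists j => //.
  by rewrite mem_enum.
by rewrite -mem_enum.
Qed.

(** * Functionals evaluated on restricted arguments *)

Section RestrictedFunctional.
Variables (R : realType) (A : algType R[i]) (B : functionals A).

(** With [m] and [n] variables, [e] can be eliminated; the lengths compared below involve
    cardinalities that are equal only through a proof. *)
Lemma functional_cast (m n : nat) (e : m = n)
    (chi' : {ffun 'I_m -> side}) (a' : {ffun 'I_m -> A})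
    (chi : {ffun 'I_n -> side}) (a : {ffun 'I_n -> A}) :
  (forall i, chi' i = chi (cast_ord e i)) ->
  (forall i, a' i = a (cast_ord e i)) -> B chi' a' = B chi a.
Proof.
subst n => c1 c2; congr (B _ _); apply/ffunP => i.
  by rewrite c1 cast_ord_id.
by rewrite c2 cast_ord_id.
Qed.

Lemma functional_restr_restr (n : nat) (chi : {ffun 'I_n -> side})
    (a : {ffun 'I_n -> A}) (V : {set 'I_n}) (W : {set 'I_#|V|}) :
  B (restr (restr chi V) W) (restr (restr a V) W) =
  B (restr chi (enum_val @: W)) (restr a (enum_val @: W)).
Proof.
have e : #|W| = #|enum_val @: W : {set 'I_n}|.
  by rewrite card_imset //; exact: enum_val_inj.
have ev i : enum_val (enum_val i) = enum_val (cast_ord e i).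
  rewrite (enum_val_nth (enum_val (enum_val i)) (cast_ord e i)).
  rewrite enum_imset_enum_val (nth_map (enum_val i)) -?cardE //=.
  by rewrite -enum_val_nth.
by apply: (functional_cast (e := e)) => i; rewrite !ffunE ev.
Qed.

Lemma functional_restr_setT (n : nat) (chi : {ffun 'I_n -> side})
    (a : {ffun 'I_n -> A}) :
  B (restr chi [set: 'I_n]) (restr a [set: 'I_n]) = B chi a.
Proof.
have e : #|[set: 'I_n]| = n by rewrite cardsT card_ord.
have ev i : enum_val i = cast_ord e i.
  apply: val_inj; rewrite /= (enum_val_nth (cast_ord e i)) enum_setT -enumT.
  by rewrite nth_enum_ord // -[X in (_ < X)%N]e.
by apply: (functional_cast (e := e)) => i; rewrite ffunE ev.
Qed.

End RestrictedFunctional.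

(** * Moments as sums of cumulant products *)

Section Expansion.
Variables (R : realType) (A : algType R[i]) (phi : {scalar A}).
Variables (B : functionals A) (B_cum : B_cumulants phi B).

(* Blocks that are not chi-intervals get weight 0, so that sums over [BI chi]
   become sums over all partitions. *)
Definition cumulant_weight (n : nat) (chi : {ffun 'I_n -> side})
    (a : {ffun 'I_n -> A}) (W : {set 'I_n}) : R[i] :=
  if chi_interval chi W then B (restr chi W) (restr a W) else 0.

Lemma moment_expansion (n : nat) (chi : {ffun 'I_n -> side})
    (a : {ffun 'I_n -> A}) : (0 < n)%N ->
  moment phi a =
  \sum_(Q : {set {set 'I_n}} | finset.partition Q [set: 'I_n])
     \prod_(W in Q) cumulant_weight chi a W.
Proof.
move=> n0; have [_ /(_ a) ->] := B_cum n0 chi; rewrite /BI.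
under eq_bigl do rewrite inE.
rewrite big_mkcondr; apply: eq_bigr => Q _; case: ifPn => [/forall_inP Qi|].
  by apply: eq_bigr => W WQ; rewrite /cumulant_weight Qi.
rewrite negb_forall_in => /exists_inP[W WQ /negPf Wi].
by rewrite (bigD1 W) //= /cumulant_weight Wi mul0r.
Qed.

(** Partitions of ['I_#|V|] correspond under [enum_val] to those of [V], and the weights agree
    because [V] is a chi-interval. [V] is nonempty since the moment-cumulant formula starts at
    length 1. *)
Lemma moment_restr_expansion (n : nat) (chi : {ffun 'I_n -> side})
    (a : {ffun 'I_n -> A}) (V : {set 'I_n}) :
  chi_interval chi V -> V != finset.set0 ->
  moment phi (restr a V) =
  \sum_(Q : {set {set 'I_n}} | finset.partition Q V)
     \prod_(W in Q) cumulant_weight chi a W.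
Proof.
move=> Vi V0; rewrite (moment_expansion (restr chi V)) ?card_gt0 //.
pose f (W : {set 'I_#|V|}) : {set 'I_n} := enum_val @: W.
have f_inj : injective f by apply: imset_inj; exact: enum_val_inj.
have fT : f [set: 'I_#|V|] = V.
  apply/setP => x; apply/imsetP/idP => [[i _ ->]|xV]; first exact: enum_valP.
  by exists (enum_rank_in xV x); rewrite ?inE ?enum_rankK_in.
rewrite [RHS](reindex_onto (fun Q : {set {set 'I_#|V|}} => f @: Q)
   (fun Q : {set {set 'I_n}} => [set W | f W \in Q])) /=; last first.
  move=> Q Qp; apply/setP => W; apply/imsetP/idP => [[U]|WQ].
    by rewrite inE => UQ ->.
  have eW : f (enum_val @^-1: W) = W.
    apply/setP => x; apply/imsetP/idP => [[k]|xW]; first by rewrite inE => ? ->.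
    have xV : x \in V := fintype.subsetP (partitionS Qp WQ) _ xW.
    by exists (enum_rank_in xV x); rewrite ?inE enum_rankK_in.
  by exists (enum_val @^-1: W); rewrite ?inE eW.
apply: eq_big => [Q|Q _].
  have -> : finset.partition (f @: Q) V = finset.partition Q [set: 'I_#|V|].
    rewrite -[RHS](imset_partition _ _ (@enum_val_inj _ (mem V))).
    exact: (congr1 (finset.partition (f @: Q)) (esym fT)).
  rewrite (_ : [set W | _] = Q) ?eqxx ?andbT //.
  by apply/setP => W; rewrite inE (mem_imset _ _ f_inj).
rewrite big_imset /=; last by move=> ? ? _ _; exact: f_inj.
apply: eq_bigr => W _; rewrite /cumulant_weight chi_interval_restr //.
by rewrite functional_restr_restr.
Qed.

Lemma moment_part_expansion (n : nat) (chi : {ffun 'I_n -> side})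
    (a : {ffun 'I_n -> A}) (P : {set {set 'I_n}}) : P \in BI chi ->
  moment_part phi P a =
  \sum_(Q : {set {set 'I_n}} |
          finset.partition Q [set: 'I_n] && refines Q P)
     \prod_(W in Q) cumulant_weight chi a W.
Proof.
rewrite inE => /andP[Pp /forall_inP Pi]; rewrite -prod_sum_partition //.
apply: eq_bigr => V VP; apply: moment_restr_expansion (Pi V VP) _.
exact: partition_neq0 Pp VP.
Qed.

End Expansion.

(** * Independence and the vanishing of mixed cumulants *)

Lemma pi_omega_BI_const (n : nat) (chi : {ffun 'I_n -> side}) (K : Type)
    (omega : 'I_n -> K) : BI_const chi omega (pi_omega chi omega).
Proof. by case: (pi_omegaP chi omega). Qed.

(** If all blocks were chi-intervals with constant [omega], then [Q] would refine [pi_omega], the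
    coarsest such partition. *)
Lemma not_refines_pi_omega (n : nat) (chi : {ffun 'I_n -> side}) (K : Type)
    (omega : 'I_n -> K) (Q : {set {set 'I_n}}) :
  finset.partition Q [set: 'I_n] -> ~~ refines Q (pi_omega chi omega) ->
  exists2 W, W \in Q &
    ~ (chi_interval chi W /\
       forall i j, i \in W -> j \in W -> omega i = omega j).
Proof.
move=> Qp; apply: contraNP => nW; apply: refines_pi_omega.
have good W : W \in Q -> chi_interval chi W /\
    forall i j, i \in W -> j \in W -> omega i = omega j.
  by move=> WQ; apply: contrapT => bad; apply: nW; exists W.
split; last by move=> W /good[].
by rewrite inE Qp; apply/forall_inP => W /good[].
Qed.

Unset Implicit Arguments.

Theorem theorem3p7 (R : realType) (A : algType R[i]) (phi : {scalar A})
    (phi1 : phi 1 = 1)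
    (K : Type) (F : K -> side -> set A)
    (F_subalg : forall k s, nonunital_subalgebra (F k s))
    (B : functionals A) (B_cum : B_cumulants phi B) :
  bi_Boolean_independent phi F <->
  (forall n : nat, (2 <= n)%N ->
   forall (chi : {ffun 'I_n -> side}) (omega : 'I_n -> K)
          (a : {ffun 'I_n -> A}),
     (forall j, F (omega j) (chi j) (a j)) ->
     ~ (forall i j, omega i = omega j) ->
     B n chi a = 0).
Proof.
have PB n (chi : {ffun 'I_n -> side}) (omega : 'I_n -> K) :
    pi_omega chi omega \in BI chi by case: (pi_omega_BI_const chi omega).
(* The vanishing of the mixed cumulant on [W] is kept as a premise, to be supplied by the assumption
   in one direction and by the induction hypothesis in the other. *)
have weight0 n (chi : {ffun 'I_n -> side}) (omega : 'I_n -> K)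
    (a : {ffun 'I_n -> A}) (W : {set 'I_n}) :
    (forall j, F (omega j) (chi j) (a j)) ->
    ((1 < #|W|)%N -> forall (omega' : 'I_#|W| -> K),
       (forall j, F (omega' j) (restr chi W j) (restr a W j)) ->
       ~ (forall i j, omega' i = omega' j) ->
       B #|W| (restr chi W) (restr a W) = 0) ->
    ~ (chi_interval chi W /\
       forall i j, i \in W -> j \in W -> omega i = omega j) ->
    cumulant_weight B chi a W = 0.
  move=> Fa IH bad; rewrite /cumulant_weight; case: ifPn => // Wi.
  have nc : ~ forall i j, i \in W -> j \in W -> omega i = omega j.
    by move=> c; apply: bad.
  apply: (IH _ (fun i => omega (enum_val i))).
  (* On at most one point [omega] is constant, so such a block has size at least 2. *)
  - rewrite ltnNge; apply/negP => W1; apply: nc => i j iW jW.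
    by congr omega; exact: (elimT card_le1_eqP W1).
  - by move=> j; rewrite !ffunE.
  - move=> c; apply: nc => i j iW jW.
    have := c (enum_rank_in iW i) (enum_rank_in iW j).
    by rewrite !enum_rankK_in.
(* The partitions finer than [pi_omega] contribute exactly the product of moments; the remaining sum
   is the defect of independence. *)
have split n (chi : {ffun 'I_n -> side}) (omega : 'I_n -> K)
    (a : {ffun 'I_n -> A}) : (0 < n)%N ->
    moment phi a = moment_part phi (pi_omega chi omega) a +
      \sum_(Q : {set {set 'I_n}} | finset.partition Q [set: 'I_n] &&
                ~~ refines Q (pi_omega chi omega))
        \prod_(W in Q) cumulant_weight B chi a W.
  move=> n0; rewrite (moment_part_expansion B_cum a (PB n chi omega)).
  by rewrite (moment_expansion B_cum chi) // -bigID.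
(* If mixed cumulants vanish, every term of the remaining sum has a zero factor. *)
split=> [indep n | vanish n n0 chi omega a Fa]; last first.
  rewrite (split n chi omega a n0) big1 ?addr0 // => Q /andP[Qp].
  move=> /(not_refines_pi_omega Qp)[W WQ bad].
  rewrite (bigD1 W) //= (weight0 _ _ omega) ?mul0r // => W1 omega' Fa'.
  exact: vanish.
have [N] := ubnP n; elim: N n => // N IH n nN n2 chi omega a Fa nc.
have n0 : (0 < n)%N by exact: ltnW.
have := split n chi omega a n0; rewrite (indep n n0 chi omega a Fa).
have topn0 : finset.set0 != [set: 'I_n].
  by rewrite eq_sym -card_gt0 cardsT card_ord.
have topp : finset.partition [set [set: 'I_n]] [set: 'I_n].
  apply/and3P; split; [by rewrite cover1 | exact: finset.trivIset1 |].
  by rewrite inE.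
(* The one-block partition is in the remaining sum because [omega] is not constant; its term is
   [B n chi a]. *)
rewrite (bigD1 [set [set: 'I_n]]) /=; last first.
  rewrite topp; apply/forall_inP => /(_ _ (set11 _))/exists_inP[W WP].
  rewrite finset.subTset => /eqP WT; apply: nc => i j.
  have [_ /(_ W WP) Wc] := pi_omega_BI_const chi omega.
  by apply: Wc; rewrite WT inE.
rewrite big_set1 big1 ?addr0.
  rewrite -[LHS]addr0 => /addrI/esym; rewrite /cumulant_weight ifT.
    by rewrite functional_restr_setT.
  by do 2!apply/forall_inP => ? _; apply/forallP => ?; rewrite inE implybT.
move=> Q /andP[/andP[Qp /(not_refines_pi_omega Qp)[W WQ bad]] QT].
rewrite (bigD1 W) //= (weight0 _ _ omega) ?mul0r // => W1 omega' Fa'.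
(* [Q] is not the one-block partition, so [W] is a proper subset and the induction hypothesis covers
   its size. *)
have WT : W \proper [set: 'I_n].
  rewrite finset.properT; apply: contraNneq QT => WT.
  apply/eqP/setP => U; rewrite inE; apply/idP/eqP => [UQ|->];
    last by rewrite -WT.
  have [x xU] := partition_block_mem Qp UQ.
  have xW : x \in W by rewrite WT inE.
  by rewrite -WT (trivIset_mem_eq (partition_trivIset Qp) UQ WQ xU xW).
apply: IH => //; apply: leq_trans (_ : n <= N)%N; last by rewrite -ltnS.
by have := proper_card WT; rewrite cardsT card_ord.
Qed.
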